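(* For all $f,g\in t\,k[[t]]$, one has $\Psi_f\Psi_g=\Psi_{f\circ g}$ as $k$-linear maps from $k\langle A\rangle$ to itself, where $f\circ g$ denotes functional composition of formal power series, i.e. $f\circ g=\sum_{i\ge 1}c_i g^i$ for $f=\sum_{i\ge1}c_it^i$.
   Context: Let $k$ be a field containing $\mathbb{Q}$, $A$ a countable set of ''letters'', $kA$ the $k$-vector space with basis $A$, and $\diamond$ an associative and commutative $k$-bilinear product on $kA$. Let $k\langle A\rangle$ be the noncommutative polynomial algebra over $A$: the $k$-vector space with basis the words $a_1a_2\cdots a_n$ ($a_i\in A$, $n\ge 0$), with concatenation product; $\ell(a_1\cdots a_n)=n$, and $1$ is the empty word. A composition of $n$ is a sequence $I=(i_1,\dots,i_m)$ of positive integers with sum $n$; $\mathcal{C}(n)$ is the set of compositions of $n$. For a word $w=a_1\cdots a_n$ and $I=(i_1,\dots,i_m)\in\mathcal{C}(n)$, put $$I[w]=(a_1\diamond\cdots\diamond a_{i_1})(a_{i_1+1}\diamond\cdots\diamond a_{i_1+i_2})\cdots(a_{i_1+\cdots+i_{m-1}+1}\diamond\cdots\diamond a_n)\in k\langle A\rangle,$$ a concatenation product of $m$ elements of $kA$. For $f=c_1t+c_2t^2+\cdots\in t\,k[[t]]$, the $k$-linear map $\Psi_f:k\langle A\rangle\to k\langle A\rangle$ is defined by $\Psi_f(1)=1$ and $\Psi_f(w)=\sum_{I=(i_1,\dots,i_m)\in\mathcal{C}(\ell(w))}c_{i_1}\cdots c_{i_m}I[w]$ for nonempty words $w$. *)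

(* Defs.v *)
From HB Require Import structures.
From mathcomp Require Import all_boot all_algebra.
From mathcomp Require Import finmap monalg.

Set Implicit Arguments.
Unset Strict Implicit.
Unset Printing Implicit Defensive.

Import GRing.Theory.
Local Open Scope ring_scope.

(* A formal power series over R is its coefficient sequence [nat -> R]; it lies
   in t R[[t]] when its coefficient of index 0 vanishes. *)

Section PowerSeries.
Variable R : nzRingType.
Implicit Types f g : nat -> R.

Definition fps_one : nat -> R := fun n => (n == 0%N)%:R.

Definition fps_mul f g : nat -> R := fun n => \sum_(i < n.+1) f i * g (n - i)%N.

Definition fps_exp g (i : nat) : nat -> R := iter i (fps_mul g) fps_one.

Lemma fps_exp_low g i n : g 0%N = 0 -> (n < i)%N -> fps_exp g i n = 0.
Proof.
move=> g0; elim: i n => // i IHi n le_n_i.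
rewrite /fps_exp iterS -/(fps_exp g i); apply: big1 => -[[|j] /= lt_j_n] _.
  by rewrite g0 mul0r.
rewrite IHi ?mulr0 //; apply: (@leq_trans n); last exact: ltnSE.
by rewrite ltn_subrL; apply: leq_trans (ltnSE lt_j_n).
Qed.

(* The coefficient of t^n in the sum of the f_i g^i over all i >= 1; the terms
   with i > n do not contribute when g 0 = 0, by fps_exp_low. *)
Definition fps_comp f g : nat -> R :=
  fun n => \sum_(1 <= i < n.+1) f i * fps_exp g i n.

Lemma fps_comp0 f g : fps_comp f g 0%N = 0.
Proof. by rewrite /fps_comp big_geq. Qed.

End PowerSeries.

Definition is_composition (n : nat) (s : seq nat) : bool :=
  all (leq 1) s && (sumn s == n).

Record composition (n : nat) := Composition {
  parts :> seq nat;
  _ : is_composition n parts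
}.

HB.instance Definition _ n := [isSub for @parts n].
HB.instance Definition _ n := [Countable of composition n by <:].

Section CompositionFinite.
Variable n : nat.

(* Finiteness: a composition of n has at most n parts, each of them at most n. *)
Lemma size_composition s : is_composition n s -> (size s <= n)%N.
Proof.
case/andP=> + /eqP <-; elim: s => //= i s IHs /andP[i_gt0 /IHs].
by rewrite -add1n; apply: leq_add.
Qed.

Lemma leq_composition s i : is_composition n s -> i \in s -> (i <= n)%N.
Proof.
case/andP=> _ /eqP <-; elim: s => //= j s IHs; rewrite inE.
case/orP=> [/eqP-> | /IHs le_i]; first exact: leq_addr.
exact: leq_trans le_i (leq_addl _ _).
Qed.

Definition bseq_of_composition (I : composition n) : n.-bseq 'I_n.+1 :=
  insub_bseq n (map inord I).

Definition composition_of_bseq (s : n.-bseq 'I_n.+1) : option (composition n) :=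
  insub (map val s).

Lemma bseq_of_compositionK : pcancel bseq_of_composition composition_of_bseq.
Proof.
case=> s sP; rewrite /composition_of_bseq /bseq_of_composition /insub_bseq.
rewrite val_insubd size_map /= size_composition // -map_comp.
suff -> : map (val \o @inord n) s = s by rewrite insubT.
apply: map_id_in => i i_s /=; rewrite inordK // ltnS.
exact: leq_composition i_s.
Qed.

HB.instance Definition _ : isFinite (composition n) :=
  PCanIsFinite bseq_of_compositionK.

End CompositionFinite.

Definition word (A : countType) := seq A.

HB.instance Definition _ (A : countType) := Choice.on (word A).

Section WordMonoid.
Variable A : countType.

Lemma word_unitm (u v : word A) : u ++ v = [::] -> u = [::] /\ v = [::].
Proof. by case: u => //= ->. Qed.

HB.instance Definition _ := Choice_isMonomialDef.Build (word A)
  (@catA A) (@cat0s A) (@cats0 A) word_unitm.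

End WordMonoid.

(* The k-vector space kA with basis A, and the algebra k<A> with basis the words
   and product extending concatenation (the monoid algebra of [word A]). *)
Notation letter_space k A := {malg k[A]}.
Notation word_algebra k A := {malg k[word A]}.

Section Psi.
Variables (k : fieldType) (A : countType).
Variable dia : letter_space k A -> letter_space k A -> letter_space k A.

Definition letter_emb (x : letter_space k A) : word_algebra k A :=
  \sum_(a <- msupp x) << x@_a *g ([:: a] : word A) >>.

(* a_1 <> ... <> a_r for r >= 1; since <> need not have a unit, the value on the
   empty word is a dummy, never reached because parts are positive. *)
Definition dia_word (u : seq A) : letter_space k A :=
  if u is a :: u' then foldl (fun x b => dia x << b >>) << a >> u' else 0.

Definition act_word (I : seq nat) (w : word A) : word_algebra k A :=
  \prod_(u <- reshape I w) letter_emb (dia_word u).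

Definition Psi_word (f : nat -> k) (w : word A) : word_algebra k A :=
  if w is [::] then 1
  else \sum_(I : composition (size w)) (\prod_(i <- I) f i) *: act_word I w.

Definition Psi (f : nat -> k) (x : word_algebra k A) : word_algebra k A :=
  \sum_(w <- msupp x) x@_w *: Psi_word f w.

Lemma PsiEw f (d : {fset word A}) x : fsubset (msupp x) d ->
  Psi f x = \sum_(w <- d) x@_w *: Psi_word f w.
Proof.
move=> le_xd; apply: (big_fset_incl _ le_xd) => w _ /mcoeff_outdom ->.
exact: scale0r.
Qed.

Lemma Psi_is_linear f : linear (Psi f).
Proof.
move=> c x y; pose d := (msupp x `|` msupp y)%fset.
have le_x : fsubset (msupp x) d := fsubsetUl _ _.
have le_y : fsubset (msupp y) d := fsubsetUr _ _.
rewrite (PsiEw f le_x) (PsiEw f le_y) (@PsiEw f d).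
  rewrite scaler_sumr -big_split; apply: eq_bigr => w _ /=.
  by rewrite mcoeffD mcoeffZ scalerDl scalerA.
apply: fsubset_trans (msuppD_le _ _) _.
by rewrite fsetSU // msuppZ_le.
Qed.

HB.instance Definition _ f :=
  GRing.isLinear.Build k (word_algebra k A) (word_algebra k A) *:%R (Psi f)
    (Psi_is_linear f).

Lemma PsiU f (w : word A) : Psi f << w >> = Psi_word f w.
Proof.
by rewrite (@PsiEw _ [fset w]%fset) ?msuppU_le // big_seq_fset1 mcoeffUU scale1r.
Qed.

End Psi.

(* Main.v *)
Require Import Defs.
From HB Require Import structures.
From mathcomp Require Import all_boot all_algebra.
From mathcomp Require Import finmap monalg.
Import GRing.Theory.
Local Open Scope ring_scope.

Set Implicit Arguments.
Unset Strict Implicit.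
Unset Printing Implicit Defensive.

(** Both Psi_f and functional composition of series are governed by cutting a
    word into consecutive blocks.  Applying Psi_g cuts a word w into blocks,
    each weighted by its coefficient of g, and merges each block with dia.
    Applying Psi_f then groups consecutive merged blocks, and associativity of
    dia makes a group of j merged blocks equal to the merge of the stretch of
    w that they cover.  For a stretch of m letters, summing the g-weights over
    all ways of cutting it into j blocks gives the coefficient of t^m in g^j.
    So the total weight of that stretch is the sum over j of f_j [t^m] g^j,
    the coefficient of t^m in the composite of f and g, which is the weight
    that Psi of the composite gives to a block of length m.

    The combinatorics is that of words over a monoid N, with a map E from N to
    an algebra.  [coarsening_sum_split] is the statement on g^j, and
    [Psi_seq_comp] follows from it by looking at the first block for f.

    To apply this with N = kA with a unit adjoined (the option type, None
    being the unit), Psi_f must be known on a concatenation of vectors of kA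
    and not only on words: both Psi_f and the sum over compositions are
    multilinear in these vectors, and they agree on basis letters
    ([Psi_prod_emb]). *)

(** * Sums over compositions *)

(** Reindexing the pairs (i, j) with i + j <= n by m = i + j. *)
Lemma sum_triangle (V : nmodType) (n : nat) (H : nat -> nat -> V) :
  \sum_(i < n.+1) \sum_(j < (n - i).+1) H i j
    = \sum_(m < n.+1) \sum_(i < m.+1) H i (m - i)%N.
Proof.
elim: n => [|n IHn]; first by rewrite !big_ord1.
rewrite big_ord_recr /= subnn big_ord1 [RHS]big_ord_recr /= -IHn.
rewrite [X in _ = _ + X]big_ord_recr /= subnn addrA -big_split /=.
by congr (_ + _); apply: eq_bigr => i _; rewrite subSn ?leq_ord // big_ord_recr.
Qed.

Section CompositionSums.
Variable V : nmodType.

Lemma sum_composition0 (F : seq nat -> V) :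
  \sum_(I : composition 0) F I = F [::].
Proof.
have nil_comp : is_composition 0 [::] by [].
rewrite (big_pred1 (Composition nil_comp)) // => I.
apply/esym/eqP/val_inj => /=.
by have := size_composition (valP I); rewrite leqn0 => /nilP.
Qed.

(** A nonempty composition is a first part m followed by a composition of
    n - m; this is the recursion by which every later sum is evaluated. *)
Lemma sum_composition_head (n : nat) (F : seq nat -> V) : (0 < n)%N ->
  \sum_(I : composition n) F I
    = \sum_(1 <= m < n.+1) \sum_(J : composition (n - m)) F (m :: J).
Proof.
move=> n_gt0; pose r m := [seq val J | J : composition (n - m)].
have r_uniq m : uniq (r m).
  by rewrite map_inj_uniq ?enum_uniq //; exact: val_inj.
have mem_r m s : (s \in r m) = is_composition (n - m) s.
  apply/imageP/idP => [[J _ ->] | sP]; first exact: valP J.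
  by exists (Composition sP).
transitivity (\sum_(s <- [seq val J | J : composition n]) F s).
  by rewrite big_image.
transitivity (\sum_(s <- [seq m :: s | m <- index_iota 1 n.+1, s <- r m]) F s);
  last by rewrite big_allpairs_dep; apply: eq_bigr => m _; rewrite big_image.
apply: perm_big; apply: uniq_perm.
- by rewrite map_inj_uniq ?enum_uniq //; exact: val_inj.
- apply: allpairs_uniq_dep => [||x y _ _]; first exact: iota_uniq.
    by move=> m _; apply: r_uniq.
  by case: x => [m s]; case: y => [m' s'] /= [-> ->].
move=> s; apply/imageP/allpairsPdep.
  case=> -[[|m t] sP] _ ->; first by move: sP n_gt0; case: (n).
  exists m, t; rewrite mem_r mem_index_iota /= ltnS; move: (sP).
  rewrite /is_composition /= => /andP[/andP[m_gt0 ->] /eqP <-].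
  by rewrite m_gt0 leq_addr addKn eqxx.
case=> m [t []]; rewrite mem_r mem_index_iota ltnS => /andP[m_gt0 le_mn] tP ->.
have mtP : is_composition n (m :: t).
  move: tP; rewrite /is_composition /= m_gt0 => /andP[-> /eqP->].
  by rewrite subnKC ?eqxx.
by exists (Composition mtP).
Qed.

End CompositionSums.

(** * Coarsenings of words over a monoid *)

Section Coarsening.
Variables (k : comNzRingType) (B : lalgType k).
Variables (N : Type) (e : N) (op : Monoid.law e).
Implicit Types (f g : nat -> k) (X Y : seq N).

Definition merge_letters X : N := \big[op/e]_(x <- X) x.

Definition merge_blocks (I : seq nat) X := map merge_letters (reshape I X).

(** The sum of F over all coarsenings of X, weighted by g.  F is arbitrary so
    that it may be a product of letters (which gives Psi_g) as well as Psi_f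
    itself (which gives Psi_f after Psi_g). *)
Definition coarsening_sum (V : lmodType k) g X (F : seq N -> V) : V :=
  \sum_(I : composition (size X)) (\prod_(i <- I) g i) *: F (merge_blocks I X).

Section Recursion.
Variable V : lmodType k.
Implicit Type F : seq N -> V.

Lemma eq_coarsening_sum g X F G : F =1 G ->
  coarsening_sum g X F = coarsening_sum g X G.
Proof. by move=> eqFG; apply: eq_bigr => I _; rewrite eqFG. Qed.

Lemma coarsening_sum_nil g F : coarsening_sum g [::] F = F [::].
Proof.
rewrite /coarsening_sum /=.
rewrite (sum_composition0
  (fun I => (\prod_(i <- I) g i) *: F (merge_blocks I [::]))).
by rewrite big_nil scale1r.
Qed.

(** Since g 0 = 0, the range can start at m = 0, which makes it match the
    range of the Cauchy product of power series. *)
Lemma coarsening_sum_head g X F : g 0%N = 0 -> X <> [::] ->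
  coarsening_sum g X F
    = \sum_(m < (size X).+1)
        g m *: coarsening_sum g (drop m X)
                 (fun Y => F (merge_letters (take m X) :: Y)).
Proof.
move=> g0 Xn0; rewrite /coarsening_sum.
rewrite (sum_composition_head
  (fun I => (\prod_(i <- I) g i) *: F (merge_blocks I X)));
  last by case: X Xn0.
rewrite [RHS]big_ord_recl g0 scale0r add0r big_add1 big_mkord.
apply: eq_bigr => m _; rewrite size_drop scaler_sumr.
by apply: eq_bigr => J _; rewrite big_cons scalerA.
Qed.

(** In a coarsening with at least j blocks, the first j blocks cover some m
    letters, and merging them merges these m letters; their weights add up to
    the coefficient of t^m in g^j.  By induction on j: splitting off the first
    block of the coarsening turns g^(j+1) into the product of g and g^j. *)
Lemma coarsening_sum_split g (j : nat) X (F : N -> seq N -> V) : g 0%N = 0 ->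
  coarsening_sum g X (fun Y =>
      if (j <= size Y)%N then F (merge_letters (take j Y)) (drop j Y) else 0)
    = \sum_(m < (size X).+1)
        fps_exp g j m *:
          coarsening_sum g (drop m X) (F (merge_letters (take m X))).
Proof.
move=> g0; elim: j X F => [|j IHj] X F.
  rewrite big_ord_recl /= big1 => [|m _]; last by rewrite /fps_one scale0r.
  rewrite /fps_one scale1r addr0 take0 drop0.
  by apply: eq_coarsening_sum => Y; rewrite take0 drop0.
have [-> | Xn0] : X = [::] \/ X <> [::] by case: (X) => [|x X']; [left | right].
  by rewrite coarsening_sum_nil big_ord1 fps_exp_low // scale0r.
rewrite coarsening_sum_head //=.
pose H i l := (g i * fps_exp g j l) *:
  coarsening_sum g (drop (i + l) X) (F (merge_letters (take (i + l) X))).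
transitivity (\sum_(i < (size X).+1) \sum_(l < (size X - i).+1) H i l).
  apply: eq_bigr => i _; rewrite -size_drop.
  have ->: coarsening_sum g (drop i X) (fun Y =>
      if (j < (size Y).+1)%N
      then F (merge_letters (merge_letters (take i X) :: take j Y)) (drop j Y)
      else 0)
    = coarsening_sum g (drop i X) (fun Y =>
      if (j <= size Y)%N
      then F (op (merge_letters (take i X)) (merge_letters (take j Y)))
             (drop j Y)
      else 0).
    by apply: eq_coarsening_sum => Y; rewrite /merge_letters big_cons.
  rewrite (IHj _ (fun y => F (op (merge_letters (take i X)) y))) scaler_sumr.
  apply: eq_bigr => l _; rewrite /H scalerA takeD drop_drop [(l + i)%N]addnC.
  by congr (_ *: coarsening_sum _ _ (F _)); rewrite /merge_letters big_cat.
rewrite sum_triangle; apply: eq_bigr => m _ /=.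
rewrite /fps_mul scaler_suml; apply: eq_bigr => i _.
by rewrite /H subnKC // leq_ord.
Qed.
End Recursion.

(* Together with the left algebra structure this makes B a k-algebra. *)
Hypothesis scaleAr : forall (c : k) (x y : B), c *: (x * y) = x * (c *: y).
Variable E : N -> B.

Definition Psi_seq f X : B := coarsening_sum f X (fun Y => \prod_(y <- Y) E y).

Lemma Psi_seq_nil f : Psi_seq f [::] = 1.
Proof. by rewrite /Psi_seq coarsening_sum_nil big_nil. Qed.

Lemma Psi_seq_head f X : f 0%N = 0 -> X <> [::] ->
  Psi_seq f X
    = \sum_(m < (size X).+1)
        f m *: (E (merge_letters (take m X)) * Psi_seq f (drop m X)).
Proof.
move=> f0 Xn0; rewrite /Psi_seq coarsening_sum_head //.
apply: eq_bigr => m _; congr (_ *: _); rewrite mulr_sumr.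
by apply: eq_bigr => I _; rewrite big_cons scaleAr.
Qed.

(** The composition law on words over N.  The j-th power of g enters through
    the coarsenings whose first j blocks are grouped by f; the remaining
    blocks form a coarsening of a shorter word. *)
Lemma Psi_seq_comp f g X : f 0%N = 0 -> g 0%N = 0 ->
  coarsening_sum g X (Psi_seq f) = Psi_seq (fps_comp f g) X.
Proof.
move=> f0 g0; have [n] := ubnP (size X); elim: n X => // n IHn X ltXn.
have [-> | Xn0] : X = [::] \/ X <> [::] by case: (X) => [|x X']; [left | right].
  by rewrite coarsening_sum_nil !Psi_seq_nil.
pose F y Y := E y * Psi_seq f Y.
(* S j collects the terms in which the first block for f has length j. *)
pose S j := coarsening_sum g X (fun Y =>
  if (j <= size Y)%N then F (merge_letters (take j Y)) (drop j Y) else 0).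
have S_eq j : S j = \sum_(m < (size X).+1)
    fps_exp g j m *: coarsening_sum g (drop m X) (F (merge_letters (take m X))).
  exact: coarsening_sum_split.
transitivity (\sum_(1 <= j < (size X).+1) f j *: S j).
  rewrite /S /coarsening_sum; under [RHS]eq_bigr do rewrite scaler_sumr.
  rewrite exchange_big; apply: eq_bigr => I _ /=.
  under [RHS]eq_bigr do rewrite scalerA mulrC -scalerA.
  rewrite -scaler_sumr; congr (_ *: _); set Y := merge_blocks I X.
  have szY : size Y = size I by rewrite size_map size_reshape.
  have Yn0 : Y <> [::].
    move=> Y0; move: szY; rewrite Y0 => /esym/eqP/nilP I0.
    have /andP[_ /eqP sumI] := valP I.
    by apply/Xn0/size0nil; rewrite -sumI /= I0.
  rewrite Psi_seq_head // big_ord_recl f0 scale0r add0r.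
  rewrite (@big_cat_nat _ _ _ (size Y).+1) //=; last first.
    by rewrite ltnS szY size_composition ?(valP I).
  rewrite [X in _ = _ + X]big1_seq ?addr0 => [|j]; last first.
    by rewrite /= mem_index_iota => /andP[ltYj _]; rewrite leqNgt ltYj scaler0.
  rewrite big_add1 big_mkord; apply: eq_bigr => j _.
  by rewrite ltn_ord.
under eq_bigr do rewrite S_eq scaler_sumr.
(* The terms with j > m vanish, which leaves the coefficient of t^m in the
   composite series. *)
rewrite exchange_big Psi_seq_head ?fps_comp0 //; apply: eq_bigr => m _ /=.
under eq_bigr do rewrite scalerA.
rewrite -scaler_suml [in LHS](@big_cat_nat _ _ _ m.+1) //=.
rewrite [X in _ + X]big1_seq ?addr0 => [|j]; last first.
  by rewrite /= mem_index_iota => /andP[ltmj _]; rewrite fps_exp_low ?mulr0.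
rewrite -/(fps_comp f g m); case: (posnP m) => [-> | m_gt0].
  by rewrite fps_comp0 !scale0r.
congr (_ *: _); rewrite -IHn; last first.
  rewrite size_drop (leq_trans _ (ltnSE ltXn)) // ltn_subrL m_gt0.
  by case: (X) Xn0.
by rewrite mulr_sumr; apply: eq_bigr => I _; rewrite /F scaleAr.
Qed.

End Coarsening.

(** * Scaling and linear maps on monoid algebras *)

Section MonoidAlgebra.
Variables (R : comNzRingType) (M : monomType).

Lemma malg_scaleAr (c : R) (x y : {malg R[M]}) : c *: (x * y) = x * (c *: y).
Proof.
apply/malgP => m; rewrite mcoeffZ (@mcoeffMlw _ _ (msupp x) (msupp y)) //.
rewrite (@mcoeffMlw _ _ (msupp x) (msupp y)) ?msuppZ_le // mulr_sumr.
apply: eq_bigr => u _; rewrite mulr_sumr; apply: eq_bigr => v _.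
by rewrite mcoeffZ mulrnAr mulrCA.
Qed.

End MonoidAlgebra.

Lemma malgU_scale (R : nzRingType) (T : choiceType) (c : R) (t : T) :
  << c *g t >> = c *: << t >> :> {malg R[T]}.
Proof. by apply/malgP => s; rewrite mcoeffZ !mcoeffU mulrnAr mulr1. Qed.

Lemma linear_malgE (R : nzRingType) (T : choiceType) (W : lmodType R)
    (h : {malg R[T]} -> W) (v : {malg R[T]}) :
  linear h -> h v = \sum_(a <- msupp v) v@_a *: h << a >>.
Proof.
move=> h_linear; pose hL : {linear {malg R[T]} -> W} :=
  HB.pack h (GRing.isLinear.Build _ _ _ _ h h_linear).
rewrite -[h v]/(hL v) {1}(monalgE v) linear_sum; apply: eq_bigr => a _.
by rewrite malgU_scale linearZ.
Qed.

(** * Psi on the word algebra *)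

Section WordAlgebra.
Variables (k : fieldType) (A : countType).
Variable dia :
  {bilinear letter_space k A -> letter_space k A -> letter_space k A}.
Hypotheses (diaA : associative dia) (diaC : commutative dia).
Local Notation V := (letter_space k A).
Implicit Types (f g : nat -> k) (X Y : seq (option V)).

(** Adjoining a unit turns dia into a monoid law, so that the merge of a block
    is an iterated product. *)
Definition unital_dia : Monoid.law (None : option V) := oAC diaA diaC.

Definition block_emb (z : option V) : word_algebra k A :=
  letter_emb (odflt 0 z).

Local Notation merge := (merge_letters unital_dia).
Local Notation Phi := (Psi_seq unital_dia block_emb).

Lemma letter_emb_linear : linear (@letter_emb k A).
Proof.
have embE (d : {fset A}) (x : V) : fsubset (msupp x) d ->
    letter_emb x = \sum_(a <- d) << x@_a *g ([:: a] : word A) >>.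
  move=> le_xd; apply: (big_fset_incl _ le_xd) => a _ /mcoeff_outdom ->.
  exact: monalgU0.
move=> c x y; pose d := (msupp x `|` msupp y)%fset.
rewrite (embE d x) ?fsubsetUl // (embE d y) ?fsubsetUr // (embE d); last first.
  by apply: fsubset_trans (msuppD_le _ _) _; rewrite fsetSU // msuppZ_le.
rewrite scaler_sumr -big_split; apply: eq_bigr => a _ /=.
apply/malgP => w; rewrite !(mcoeffD, mcoeffZ, mcoeffU).
by rewrite mulrnDl mulrnAr.
Qed.

Lemma merge_slot_linear X Y :
  linear (fun v : V => block_emb (merge (X ++ Some v :: Y))).
Proof.
move=> c u v; rewrite /merge_letters !big_cat !big_cons /block_emb.
rewrite -letter_emb_linear; congr letter_emb.
by case: (bigop _ _ _) => [x|]; case: (bigop _ _ _) => [y|] //=;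
  rewrite ?linearPl ?linearPr ?linearPl.
Qed.

(** Each coarsening puts the letter v into exactly one block: by induction on
    the letters before it, this is the first block or a later one. *)
Lemma Phi_slot_linear f X Y : f 0%N = 0 ->
  linear (fun v : V => Phi f (X ++ Some v :: Y)).
Proof.
move=> f0; have [n] := ubnP (size X); elim: n X => // n IHn X ltXn c u v.
rewrite !(Psi_seq_head _ (@malg_scaleAr k (word A))) //; try by case: (X).
rewrite !size_cat /= scaler_sumr -big_split; apply: eq_bigr => -[m _] _ /=.
have [lemX | ltXm] := leqP m (size X).
  have [-> | m_gt0] := posnP m; first by rewrite f0 !scale0r scaler0 addr0.
  have dropX Z : drop m (X ++ Z) = drop m X ++ Z.
    by rewrite -{1}(cat_take_drop m X) -catA drop_size_cat // size_takel.
  rewrite !takel_cat // !dropX IHn; last first.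
    rewrite size_drop (leq_trans _ (ltnSE ltXn)) // ltn_subrL m_gt0.
    exact: leq_trans lemX.
  by rewrite mulrDr scalerDr -malg_scaleAr !scalerA mulrC.
rewrite !take_cat !drop_cat ltnNge ltnW //= -(subnSK ltXm) /=.
by rewrite merge_slot_linear mulrDl scalerDr -scalerAl !scalerA [c * _]mulrC.
Qed.

Lemma Psi_wordE f (w : word A) :
  Psi_word dia f w
    = \sum_(I : composition (size w)) (\prod_(i <- I) f i) *: act_word dia I w.
Proof.
case: w => [|a w] //=.
rewrite (sum_composition0
  (fun I => (\prod_(i <- I) f i) *: act_word dia I [::])).
by rewrite /act_word /= !big_nil scale1r.
Qed.

Lemma merge_word (u : word A) :
  odflt 0 (merge [seq Some << a >> | a <- u]) = dia_word dia u.
Proof.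
case: u => [|a u]; first by rewrite /merge_letters big_nil.
rewrite /merge_letters big_map /=.
suff H (x : V) :
    unital_dia (Some x) (\big[unital_dia/None]_(b <- u) Some << b >>)
    = Some (foldl (fun x b => dia x << b >>) x u).
  by rewrite big_cons H.
elim: u x => [|b u IHu] x; first by rewrite big_nil Monoid.mulm1.
by rewrite big_cons Monoid.mulmA /= IHu.
Qed.

Lemma Psi_word_Phi f (w : word A) :
  Psi_word dia f w = Phi f [seq Some << a >> | a <- w].
Proof.
rewrite Psi_wordE /Psi_seq /coarsening_sum size_map.
apply: eq_bigr => I _; congr (_ *: _).
rewrite /merge_blocks -map_reshape -map_comp big_map /act_word.
by apply: eq_bigr => u _; rewrite /= /block_emb merge_word.
Qed.

(** Multilinear extension of [Psi_word_Phi] from words to concatenations of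
    vectors.  The letters of u are those factors already expanded in the basis
    of kA; the induction expands the remaining ones from left to right. *)
Lemma Psi_prod_emb f (u : word A) (vs : seq V) : f 0%N = 0 ->
  Psi dia f (<< u >> * \prod_(v <- vs) letter_emb v)
    = Phi f ([seq Some << a >> | a <- u] ++ map Some vs).
Proof.
move=> f0; elim: vs u => [|v vs IHvs] u.
  by rewrite big_nil mulr1 PsiU Psi_word_Phi cats0.
rewrite big_cons mulrA /= (linear_malgE _ (Phi_slot_linear _ _ f0)).
rewrite {1}/letter_emb mulr_sumr mulr_suml linear_sum; apply: eq_bigr => a _.
rewrite (malgU_scale v@_a) -malg_scaleAr -scalerAl linearZ /=; congr (_ *: _).
by rewrite malgM_def fgmulUU mulr1 IHvs map_cat -catA.
Qed.

Lemma reshape_nonempty (T : eqType) (I : seq nat) (w : seq T) (u : seq T) :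
  is_composition (size w) I -> u \in reshape I w -> u <> [::].
Proof.
case/andP => /allP I_gt0 /eqP sumI uI u0.
have : 0%N \in I.
  rewrite -(@reshapeKl _ I w) ?sumI //.
  by apply/mapP; exists u => //; rewrite u0.
by move/I_gt0.
Qed.

(** The blocks of a composition are nonempty, so their merges are genuine
    elements of kA and never the adjoined unit. *)
Lemma Psi_act_word f (w : word A) (I : composition (size w)) : f 0%N = 0 ->
  Psi dia f (act_word dia I w)
    = Phi f (merge_blocks unital_dia I [seq Some << a >> | a <- w]).
Proof.
move=> f0; rewrite /act_word -(big_map (dia_word dia) xpredT (@letter_emb k A)).
rewrite -[X in Psi _ _ X]mul1r (Psi_prod_emb [::]) //=; congr (Phi f _).
rewrite /merge_blocks -map_reshape -!map_comp; apply/eq_in_map => u.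
move/(reshape_nonempty (valP I)); rewrite /= -merge_word.
case: u => // a u _; rewrite /merge_letters /= big_cons.
by case: (bigop _ _ _).
Qed.

Lemma Psi_Psi_word f g (w : word A) : f 0%N = 0 -> g 0%N = 0 ->
  Psi dia f (Psi_word dia g w) = Psi_word dia (fps_comp f g) w.
Proof.
move=> f0 g0; rewrite [RHS]Psi_word_Phi.
rewrite -(Psi_seq_comp _ (@malg_scaleAr k (word A))) //.
rewrite Psi_wordE linear_sum /coarsening_sum size_map.
by apply: eq_bigr => I _; rewrite linearZ /= Psi_act_word.
Qed.

End WordAlgebra.

Theorem theorem3p1 (k : fieldType) (QtoK : {rmorphism rat -> k})
    (A : countType)
    (dia : {bilinear letter_space k A -> letter_space k A -> letter_space k A})
    (diaA : associative dia) (diaC : commutative dia)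
    (f g : nat -> k) (f0 : f 0%N = 0) (g0 : g 0%N = 0) :
  Psi dia f \o Psi dia g =1 Psi dia (fps_comp f g).
Proof.
move=> x /=; rewrite {2}/Psi linear_sum; apply: eq_bigr => w _.
by rewrite linearZ /= Psi_Psi_word.
Qed.
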